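(* Let $n\ge2$, $\mathbf{a}\in\mathbb{C}^n$, $\beta>0$ and $f(\mathbf{z})=\frac12|\mathbf{a}^*\mathbf{z}|^2+\frac{\beta}{2}\|\mathbf{z}\|_4^4$ on $\mathbb{CS}^{n-1}$. There exists a local minimizer $\mathbf{z}$ of $f$ on $\mathbb{CS}^{n-1}$ with $\mathbf{a}^*\mathbf{z}=0$ if and only if either $\|\mathbf{a}\|_\infty\le\frac12\|\mathbf{a}\|_1$, or $\mathbf{a}$ has exactly one nonzero component and $\|\mathbf{a}\|_2^2\ge 2\beta/(n-1)$. Further, if $\mathbf{a}$ satisfies one of these conditions, then the local minimizers $\mathbf{z}$ with $\mathbf{a}^*\mathbf{z}=0$ are exactly the global minimizers of $f$ on $\mathbb{CS}^{n-1}$.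
   Context: $\mathbb{CS}^{n-1}=\{\mathbf{z}\in\mathbb{C}^n:\|\mathbf{z}\|_2=1\}$; $\|\mathbf{z}\|_4^4=\sum_k|z_k|^4$. *)

(* Defs.v *)
From HB Require Import structures.
From mathcomp Require Import all_boot all_order all_algebra.
From mathcomp Require Import reals.
From mathcomp.real_closed Require Import complex.
Set Implicit Arguments. Unset Strict Implicit. Unset Printing Implicit Defensive.
Import Order.TTheory GRing.Theory Num.Theory.
Local Open Scope ring_scope.
Local Open Scope complex_scope.

Definition cabs2 (R : realType) (c : R[i]) : R := (@complex.Re R c) ^+ 2 + (@complex.Im R c) ^+ 2.

Definition cabs (R : realType) (c : R[i]) : R := Num.sqrt (cabs2 c).

Definition cinner (R : realType) (n : nat) (a z : 'I_n -> R[i]) : R[i] :=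
  \sum_(k < n) (a k)^* * z k.

Definition norm2sq (R : realType) (n : nat) (z : 'I_n -> R[i]) : R :=
  \sum_(k < n) cabs2 (z k).

Definition norm4pow4 (R : realType) (n : nat) (z : 'I_n -> R[i]) : R :=
  \sum_(k < n) (cabs2 (z k)) ^+ 2.

Definition norm1 (R : realType) (n : nat) (a : 'I_n -> R[i]) : R :=
  \sum_(k < n) cabs (a k).
Definition norminf (R : realType) (n : nat) (a : 'I_n -> R[i]) : R :=
  \big[Num.max/0]_(k < n) cabs (a k).

Definition on_sphere (R : realType) (n : nat) (z : 'I_n -> R[i]) : Prop :=
  norm2sq z = 1.

Definition fobj (R : realType) (n : nat) (a : 'I_n -> R[i]) (beta : R)
  (z : 'I_n -> R[i]) : R :=
  2^-1 * cabs2 (cinner a z) + beta / 2 * norm4pow4 z.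

Definition local_min_sphere (R : realType) (n : nat) (f : ('I_n -> R[i]) -> R)
  (z : 'I_n -> R[i]) : Prop :=
  on_sphere z /\
  exists2 eps : R, 0 < eps &
    forall w : 'I_n -> R[i], on_sphere w ->
      norm2sq (fun k => w k - z k) < eps ^+ 2 -> f z <= f w.

Definition global_min_sphere (R : realType) (n : nat) (f : ('I_n -> R[i]) -> R)
  (z : 'I_n -> R[i]) : Prop :=
  on_sphere z /\ forall w : 'I_n -> R[i], on_sphere w -> f z <= f w.

(* Main.v *)
Require Import Defs.
From HB Require Import structures.
From mathcomp Require Import all_boot all_order all_algebra.
From mathcomp Require Import reals.
From mathcomp.real_closed Require Import complex.
From mathcomp Require Import ring lra.
Import Order.TTheory GRing.Theory Num.Theory.
Local Open Scope ring_scope.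
Local Open Scope complex_scope.

Set Implicit Arguments.
Unset Strict Implicit.
Unset Printing Implicit Defensive.

(** Suppose z is a local minimizer with
    a^* z = 0.  Along the curves (z + t v) / |z + t v| with v tangent, f(z) is the
    constant term of a quartic in t after clearing denominators, so its linear
    coefficient vanishes and its quadratic one is nonnegative.  Radial directions
    in a single coordinate give |z_k|^2 = Q := |z|_4^4 whenever z_k <> 0.
    Directions with Re (conj z_k v_k) = 0 for all k give
    2 beta Q |v_j|^2 <= |a^* v|^2 whenever z_j = 0; two-coordinate choices of v
    with a^* v = 0 then force a_j to be the only nonzero entry of a and z_j the only
    zero entry of z.  So z is either flat, in which case the numbers
    conj a_k z_k close up to a polygon with sides |a_k| / sqrt n, or a is supported
    at j and z is flat off j.  Both shapes are global minimizers, by completing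
    squares in the variables |w_k|^2. *)

(** * Complex moduli, and polygons with prescribed side lengths *)

Section ModulusFacts.
Variable R : realType.
Implicit Types (c d : R[i]) (x y r : R).

(** The inner product of the plane, [Re (c^* * d)]. *)
Definition rdot c d : R :=
  complex.Re c * complex.Re d + complex.Im c * complex.Im d.

Lemma cabs2_ge0 c : 0 <= cabs2 c.
Proof. by rewrite addr_ge0 ?sqr_ge0. Qed.

Lemma cabs2_eq0 c : (cabs2 c == 0) = (c == 0).
Proof.
by case: c => x y; rewrite /cabs2 paddr_eq0 ?sqr_ge0 // !sqrf_eq0 eq_complex.
Qed.

Lemma cabs20 : cabs2 (0 : R[i]) = 0.
Proof. by apply/eqP; rewrite cabs2_eq0. Qed.

Lemma cabs2M c d : cabs2 (c * d) = cabs2 c * cabs2 d.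
Proof. by case: c d => [x y] [u v]; rewrite /cabs2 /=; ring. Qed.

Lemma cabs2D c d : cabs2 (c + d) = cabs2 c + 2 * rdot c d + cabs2 d.
Proof. by case: c d => [x y] [u v]; rewrite /cabs2 /rdot /=; ring. Qed.

Lemma cabs2N c : cabs2 (- c) = cabs2 c.
Proof. by case: c => x y; rewrite /cabs2 /= !sqrrN. Qed.

Lemma cabs2_real x : cabs2 x%:C = x ^+ 2.
Proof. by rewrite /cabs2 /= expr0n addr0. Qed.

Lemma cabs2_conj c : cabs2 c^* = cabs2 c.
Proof. by case: c => x y; rewrite /cabs2 /= sqrrN. Qed.

Lemma rdot_realr x c d : rdot c (x%:C * d) = x * rdot c d.
Proof. by case: c d => [p q] [u v]; rewrite /rdot /=; ring. Qed.

Lemma rdotDr c d e : rdot c (d + e) = rdot c d + rdot c e.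
Proof. by case: c d e => [p q] [u v] [s t]; rewrite /rdot /=; ring. Qed.

Lemma rdotcc c : rdot c c = cabs2 c.
Proof. by rewrite /rdot -!expr2. Qed.

Lemma rdot0l c : rdot 0 c = 0.
Proof. by rewrite /rdot /= !mul0r addr0. Qed.

Lemma rdot0r c : rdot c 0 = 0.
Proof. by rewrite /rdot /= !mulr0 addr0. Qed.

Lemma rdot_mulIr c : rdot c ('i * c) = 0.
Proof. by case: c => x y; rewrite /rdot /=; ring. Qed.

Lemma cabs_ge0 c : 0 <= cabs c.
Proof. exact: sqrtr_ge0. Qed.

Lemma sqr_cabs c : cabs c ^+ 2 = cabs2 c.
Proof. by rewrite sqr_sqrtr ?cabs2_ge0. Qed.

Lemma cabs_eq0 c : (cabs c == 0) = (c == 0).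
Proof. by rewrite -sqrf_eq0 sqr_cabs cabs2_eq0. Qed.

Lemma cabs_real x : 0 <= x -> cabs x%:C = x.
Proof. by move=> x0; rewrite /cabs cabs2_real sqrtr_sqr ger0_norm. Qed.

Lemma cabsE c : (cabs c)%:C = `|c|.
Proof. by case: c => x y. Qed.

Lemma cabs_sum (I : Type) (s : seq I) (P : pred I) (F : I -> R[i]) :
  cabs (\sum_(i <- s | P i) F i) <= \sum_(i <- s | P i) cabs (F i).
Proof.
rewrite -lecR cabsE rmorph_sum (le_trans (ler_norm_sum _ _ _)) //.
by rewrite le_eqVlt; apply/orP; left; apply/eqP; apply: eq_bigr => i _; rewrite -cabsE.
Qed.

Lemma polar_form c : exists2 u, cabs2 u = 1 & c = (cabs c)%:C * u.
Proof.
have [->|c0] := eqVneq c 0.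
  by exists 1; rewrite ?cabs2_real ?expr1n // cabs_real // mulr1.
have k0 : cabs c != 0 by rewrite cabs_eq0.
exists ((cabs c)^-1%:C * c); last by rewrite mulrA -rmorphM divff // mul1r.
by rewrite cabs2M cabs2_real exprVn sqr_cabs mulVf // cabs2_eq0.
Qed.

(** Lay the side [r] along the real axis from 0. The law of cosines gives the abscissa [p] of the
    apex at distance [x] from 0 and [y] from [r], and Pythagoras its height [q]. *)
Lemma triangle_exists x y r : 0 <= x -> 0 <= y -> 0 <= r ->
    r <= x + y -> x <= r + y -> y <= r + x ->
  exists u v, [/\ cabs2 u = 1, cabs2 v = 1 & x%:C * u + y%:C * v = r%:C].
Proof.
move=> x0 y0 r0 rxy xry yrx.
suff [c [d [cx dy cd]]] : exists c d, [/\ cabs2 c = x ^+ 2,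
    cabs2 d = y ^+ 2 & c + d = r%:C].
  have [u u1 cu] := polar_form c; have [v v1 dv] := polar_form d.
  exists u, v; split=> //; rewrite -cd cu dv /cabs cx dy.
  by rewrite !sqrtr_sqr !ger0_norm.
(* The formula for [p] divides by [r]; when [r = 0] the inequalities force [x = y] and opposite
   vectors do. *)
have [r_eq0|r_neq0] := eqVneq r 0.
  exists x%:C, (- x%:C); rewrite cabs2N !cabs2_real; split=> //.
    by congr (_ ^+ 2); lra.
  by rewrite subrr r_eq0.
have r_gt0 : 0 < r by rewrite lt_def r_neq0.
pose p := (r ^+ 2 + x ^+ 2 - y ^+ 2) / (2 * r).
have pE : 2 * r * p = r ^+ 2 + x ^+ 2 - y ^+ 2 by rewrite /p; field.
(* After clearing [2 * r], [- x <= p <= x] reads [(r - x)^2 <= y^2 <= (r + x)^2]. *)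
have q0 : 0 <= x ^+ 2 - p ^+ 2.
  have h1 : p <= x.
    by rewrite /p ler_pdivrMr ?mulr_gt0 //; nra.
  have h2 : - x <= p.
    by rewrite /p ler_pdivlMr ?mulr_gt0 //; nra.
  nra.
pose q := Num.sqrt (x ^+ 2 - p ^+ 2).
have qE : q ^+ 2 = x ^+ 2 - p ^+ 2 by rewrite /q sqr_sqrtr.
exists (p +i* q), ((r - p) +i* (- q)); split.
- by rewrite /cabs2 /= qE; ring.
- by rewrite /cabs2 /= sqrrN qE; move: pE; clear; nra.
- by apply/eqP; rewrite eq_complex /=; apply/andP; split; apply/eqP; ring.
Qed.

(* In the inductive step the tail must close up with some magnitude [rho'] subject
   to several lower bounds and the upper bounds [rho + r x] and [S]; taking the
   smaller upper bound reduces everything to pairwise comparisons. *)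
Lemma polygon_exists (I : eqType) (s : seq I) (r : I -> R) (rho : R) :
    uniq s -> (forall i, 0 <= r i) -> 0 <= rho -> rho <= \sum_(i <- s) r i ->
    {in s, forall i, 2 * r i <= rho + \sum_(i <- s) r i} ->
  exists2 u : I -> R[i], forall i, cabs2 (u i) = 1 &
    \sum_(i <- s) (r i)%:C * u i = rho%:C.
Proof.
move=> us r0; elim: s us rho => [_|x s IHs /= /andP[xs us]] rho rho0.
  rewrite big_nil => rho_le0 _; exists (fun=> 1).
    by move=> _; rewrite cabs2_real expr1n.
  by rewrite big_nil; congr (_%:C); apply/eqP; rewrite eq_le rho0.
rewrite big_cons => rho_le r_le.
set S := \sum_(i <- s) r i in rho_le r_le *.
have S0 : 0 <= S by apply: sumr_ge0.
pose rho' := Num.min (rho + r x) S.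
have x_le := r_le x (mem_head _ _).
have r'0 : 0 <= rho' by rewrite le_min S0 addr_ge0.
have r'1 : rho' <= rho + r x by rewrite ge_min lexx.
have r'2 : rho' <= S by rewrite ge_min lexx orbT.
have r'3 t : t <= rho + r x -> t <= S -> t <= rho'.
  by move=> h1 h2; rewrite le_min h1.
have rx0 := r0 x.
have [|||u u1 us_eq] := IHs us rho' => //.
  move=> i si; have := r_le i; rewrite inE si orbT => /(_ isT) hi.
  rewrite -/S; suff : 2 * r i - S <= rho' by lra.
  apply: r'3; first lra.
  suff : r i <= S by lra.
  by rewrite /S (big_rem i) //= lerDl sumr_ge0.
have h1 : rho - r x <= rho' by apply: r'3; lra.
have h2 : r x - rho <= rho' by apply: r'3; lra.
have [||||||v [w [v1 w1 vw]]] := @triangle_exists (r x) rho' rho => //; try lra.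
(* The tail sums to the real number [rho']; rotating it by [w] makes it the second side of the
   triangle. *)
exists (fun i => if i == x then v else w * u i).
  by move=> i; case: ifP => // _; rewrite cabs2M w1 u1 mulr1.
rewrite big_cons eqxx -vw -us_eq mulr_suml; congr (_ + _).
apply: eq_big_seq => i si; case: eqP => [ix|_]; first by rewrite ix (negPf xs) in si.
by rewrite -mulrA [w * _]mulrC.
Qed.

End ModulusFacts.

(** * Low-order coefficients of polynomials nonnegative near 0 *)

Section SmallPolynomials.
Variable R : realFieldType.
Implicit Types c K e delta t : R.

(** For [0 < t <= 1] the higher terms are at most [C * t]. If [c0 < 0], the chosen [t] makes this at
    most [- c0 / 2], so the cubic is negative there; [C + 1] avoids dividing by zero. *)
Lemma cubic_constant_coef_ge0 delta c0 c1 c2 c3 : 0 < delta ->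
    (forall t, 0 < t -> t <= delta ->
      0 <= c0 + c1 * t + c2 * t ^+ 2 + c3 * t ^+ 3) ->
  0 <= c0.
Proof.
move=> d0 h; rewrite leNgt; apply/negP => c0_lt0.
pose C := `|c1| + `|c2| + `|c3|.
have C0 : 0 <= C by rewrite !addr_ge0.
have q0 : 0 < - c0 / (2 * (C + 1)) by rewrite divr_gt0 ?oppr_gt0 //; lra.
pose t := Num.min (Num.min delta 1) (- c0 / (2 * (C + 1))).
have t0 : 0 < t by rewrite !lt_min d0 ltr01 q0.
have t1 : t <= 1 by rewrite !ge_min lexx orbT.
have td : t <= delta by rewrite !ge_min lexx.
have tC : t * (2 * (C + 1)) <= - c0.
  by rewrite -ler_pdivlMr ?ge_min ?lexx ?orbT //; lra.
have := h t t0 td.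
have h1 : c1 * t <= `|c1| * t by rewrite ler_pM2r // ler_norm.
have h2 : c2 * t ^+ 2 <= `|c2| * t.
  apply: (@le_trans _ _ (`|c2| * t ^+ 2)).
    by rewrite ler_pM2r ?exprn_gt0 // ler_norm.
  by rewrite ler_wpM2l // expr2 ger_pMr.
have h3 : c3 * t ^+ 3 <= `|c3| * t.
  apply: (@le_trans _ _ (`|c3| * t ^+ 3)).
    by rewrite ler_pM2r ?exprn_gt0 // ler_norm.
  by rewrite ler_wpM2l // exprS ger_pMr // expr_le1 // ltW.
have hC : C * t = `|c1| * t + `|c2| * t + `|c3| * t by rewrite /C !mulrDl.
nra.
Qed.

(** Dividing by [t] gives [0 <= c1], and the same at [- t] gives [c1 <= 0]; then dividing by
    [t ^+ 2] exposes [c2]. *)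
Lemma quartic_low_coefs K e c1 c2 c3 c4 : 0 <= K -> 0 < e ->
    (forall t, t ^+ 2 * K < e ->
      0 <= c1 * t + c2 * t ^+ 2 + c3 * t ^+ 3 + c4 * t ^+ 4) ->
  c1 = 0 /\ 0 <= c2.
Proof.
move=> K0 e0 h.
pose d := Num.min 1 (e / (K + 1)).
have K1 : 0 < K + 1 by lra.
have d0 : 0 < d by rewrite lt_min ltr01 divr_gt0.
have small t : 0 < t -> t <= d -> t ^+ 2 * K < e.
  move=> t0 td.
  have t1 : t <= 1 by apply: le_trans td _; rewrite ge_min lexx.
  have te : t * (K + 1) <= e.
    by rewrite -ler_pdivlMr // (le_trans td) // ge_min lexx orbT.
  nra.
have c1_ge0 : 0 <= c1.
  apply: (@cubic_constant_coef_ge0 d _ c2 c3 c4 d0) => t t0 td.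
  by rewrite -(pmulr_rge0 _ t0); have := h t (small t t0 td); lra.
have c1_le0 : 0 <= - c1.
  apply: (@cubic_constant_coef_ge0 d _ c2 (- c3) c4 d0) => t t0 td.
  rewrite -(pmulr_rge0 _ t0).
  by have := h (- t); rewrite sqrrN => /(_ (small t t0 td)); lra.
have c1_0 : c1 = 0 by lra.
split=> //.
apply: (@cubic_constant_coef_ge0 d _ c3 c4 0 d0) => t t0 td.
rewrite -(pmulr_rge0 _ (exprn_gt0 2 t0)).
by have := h t (small t t0 td); rewrite c1_0; lra.
Qed.

End SmallPolynomials.

(** * First- and second-order conditions at a local minimizer *)

Section SphereObjective.
Variables (R : realType) (n : nat).
Implicit Types (a z v w : 'I_n -> R[i]) (beta : R) (j k l : 'I_n).

Lemma sum_delta k (F : 'I_n -> R) : \sum_(l < n) (l == k)%:R * F l = F k.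
Proof.
rewrite (bigD1 k) //= eqxx mul1r big1 ?addr0 // => l /negPf ->.
by rewrite mul0r.
Qed.

Lemma norm2sq_ge0 z : 0 <= norm2sq z.
Proof. by apply: sumr_ge0 => k _; apply: cabs2_ge0. Qed.

Lemma norm4pow4_gt0 z : on_sphere z -> 0 < norm4pow4 z.
Proof.
move=> z1; have Q0 : 0 <= norm4pow4 z by apply: sumr_ge0 => k _; apply: sqr_ge0.
rewrite lt_def Q0 andbT; apply/eqP => /psumr_eq0P h.
move: z1; rewrite /on_sphere /norm2sq big1 => [/eqP|k _].
  by rewrite eq_sym oner_eq0.
by apply/eqP; rewrite -sqrf_eq0 h // => l _; apply: sqr_ge0.
Qed.

Lemma cinner_perturb a z v (t : R) :
  cinner a (fun k => z k + t%:C * v k) = cinner a z + t%:C * cinner a v.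
Proof.
rewrite /cinner mulr_sumr -big_split /=; apply: eq_bigr => k _; ring.
Qed.

Lemma cinner_scale a z (t : R) :
  cinner a (fun k => t%:C * z k) = t%:C * cinner a z.
Proof. by rewrite /cinner mulr_sumr; apply: eq_bigr => k _; ring. Qed.

Lemma norm2sq_scale z (t : R) :
  norm2sq (fun k => t%:C * z k) = t ^+ 2 * norm2sq z.
Proof.
by rewrite /norm2sq mulr_sumr; apply: eq_bigr => k _; rewrite cabs2M cabs2_real.
Qed.

Lemma norm4pow4_scale z (t : R) :
  norm4pow4 (fun k => t%:C * z k) = t ^+ 4 * norm4pow4 z.
Proof.
rewrite /norm4pow4 mulr_sumr; apply: eq_bigr => k _.
by rewrite cabs2M cabs2_real exprMn -exprM.
Qed.

Lemma norm2sq_perturb z v (t : R) :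
  norm2sq (fun k => z k + t%:C * v k) =
  norm2sq z + 2 * t * (\sum_(k < n) rdot (z k) (v k)) + t ^+ 2 * norm2sq v.
Proof.
rewrite /norm2sq !mulr_sumr -!big_split /=; apply: eq_bigr => k _.
by rewrite cabs2D rdot_realr cabs2M cabs2_real; ring.
Qed.

Lemma norm4pow4_perturb z v (t : R) :
  norm4pow4 (fun k => z k + t%:C * v k) =
  norm4pow4 z + t * (4 * \sum_(k < n) cabs2 (z k) * rdot (z k) (v k))
  + t ^+ 2 * (\sum_(k < n) (4 * rdot (z k) (v k) ^+ 2
                            + 2 * cabs2 (z k) * cabs2 (v k)))
  + t ^+ 3 * (4 * \sum_(k < n) rdot (z k) (v k) * cabs2 (v k))
  + t ^+ 4 * norm4pow4 v.
Proof.
rewrite /norm4pow4 !mulr_sumr -!big_split /=; apply: eq_bigr => k _.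
by rewrite cabs2D rdot_realr cabs2M cabs2_real; ring.
Qed.

Lemma norm2sq_sub_sphere z w : on_sphere z -> on_sphere w ->
  norm2sq (fun k => w k - z k) = 2 - 2 * \sum_(k < n) rdot (z k) (w k).
Proof.
rewrite /on_sphere => z1 w1.
have -> : 2 - 2 * \sum_(k < n) rdot (z k) (w k) =
    norm2sq w + (- 2) * (\sum_(k < n) rdot (z k) (w k)) + norm2sq z.
  by rewrite z1 w1; ring.
rewrite /norm2sq mulr_sumr -!big_split /=; apply: eq_bigr => k _.
by case: (z k) (w k) => [x y] [u v']; rewrite /cabs2 /rdot /=; ring.
Qed.

(* The competitors are the normalised points [(z + t v) / |z + t v|]; clearing
   the denominator makes [f w - f z] a quartic in [t] without constant term. *)
Lemma local_min_variation a beta z v : 0 < beta ->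
    local_min_sphere (fobj a beta) z -> cinner a z = 0 ->
    \sum_(k < n) rdot (z k) (v k) = 0 ->
  \sum_(k < n) cabs2 (z k) * rdot (z k) (v k) = 0 /\
  0 <= cabs2 (cinner a v) +
       beta * (\sum_(k < n) (4 * rdot (z k) (v k) ^+ 2
                             + 2 * cabs2 (z k) * cabs2 (v k))
               - 2 * norm4pow4 z * norm2sq v).
Proof.
move=> b0 [z1 [eps eps0 zmin]] az0 vz0.
set L1 := \sum_(k < n) _ * _; set L2 := \sum_(k < n) (_ + _).
set A := cabs2 _; set Q := norm4pow4 z; set M := norm2sq v.
have M0 : 0 <= M by apply: norm2sq_ge0.
pose L3 := \sum_(k < n) rdot (z k) (v k) * cabs2 (v k).
suff [h1 h2] : beta / 2 * (4 * L1) = 0 /\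
    0 <= 2^-1 * A + beta / 2 * (L2 - 2 * Q * M).
  split; last lra.
  move/eqP: h1; rewrite !mulf_eq0 invr_eq0 !pnatr_eq0 (gt_eqF b0) /=.
  by move/eqP.
apply: (@quartic_low_coefs _ (2 * M) (eps ^+ 2) _ _ (beta / 2 * (4 * L3))
          (2^-1 * A * M + beta / 2 * (norm4pow4 v - Q * M ^+ 2))).
- by rewrite mulr_ge0.
- by rewrite exprn_gt0.
move=> t tM.
have N0 : 0 < 1 + t ^+ 2 * M by rewrite ltr_pwDl // mulr_ge0 ?sqr_ge0.
pose s := (Num.sqrt (1 + t ^+ 2 * M))^-1.
have s0 : 0 < s by rewrite invr_gt0 sqrtr_gt0.
have sE : s ^+ 2 * (1 + t ^+ 2 * M) = 1.
  by rewrite exprVn sqr_sqrtr ?(ltW N0) // mulVf ?gt_eqF.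
pose w k := s%:C * (z k + t%:C * v k).
have w1 : on_sphere w.
  by rewrite /on_sphere norm2sq_scale norm2sq_perturb vz0 z1 mulr0 addr0.
have tM0 : 0 <= t ^+ 2 * M by rewrite mulr_ge0 ?sqr_ge0.
(* The squared distance is [2 - 2 * s], and [1 - s <= 1 - s ^+ 2 = s ^+ 2 * X <= X] with
   [X = t ^+ 2 * M]; hence the bound [2 * M] passed above. *)
have wz : norm2sq (fun k => w k - z k) < eps ^+ 2.
  rewrite (norm2sq_sub_sphere z1 w1).
  have -> : \sum_(k < n) rdot (z k) (w k) = s.
    have -> : s = s * (norm2sq z + t * \sum_(k < n) rdot (z k) (v k)).
      by rewrite z1 vz0; ring.
    rewrite /norm2sq mulr_sumr -big_split /= mulr_sumr; apply: eq_bigr => k _.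
    by rewrite !rdot_realr rdotDr rdot_realr rdotcc.
  set X := t ^+ 2 * M in sE tM0.
  have s1 : s <= 1 by nra.
  have s2 : s ^+ 2 <= s by rewrite expr2 ger_pMr.
  have sX : s ^+ 2 * X <= X by rewrite ler_piMl // (le_trans s2).
  have : 2 * X < eps ^+ 2 by rewrite /X mulrCA.
  lra.
have := zmin w w1 wz; rewrite /fobj az0 cabs20 cinner_scale cinner_perturb az0.
rewrite add0r !cabs2M !cabs2_real norm4pow4_scale norm4pow4_perturb.
rewrite -/A -/Q -/L1 -/L2 -/L3 => H.
set P := Q + _ + _ + _ + _ in H.
(* As [s ^+ 2] is inverse to [1 + t ^+ 2 * M], this is [f w - f z] with [s ^+ 4] factored out,
   leaving a polynomial in [t]. *)
suff : 0 <= s ^+ 4 * (2^-1 * A * t ^+ 2 * (1 + t ^+ 2 * M)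
                      + beta / 2 * (P - Q * (1 + t ^+ 2 * M) ^+ 2)).
  rewrite pmulr_rge0 ?exprn_gt0 // => H2; apply: (le_trans H2).
  by rewrite /P le_eqVlt; apply/orP; left; apply/eqP; ring.
have -> : s ^+ 4 * (2^-1 * A * t ^+ 2 * (1 + t ^+ 2 * M)
                      + beta / 2 * (P - Q * (1 + t ^+ 2 * M) ^+ 2)) =
   2^-1 * A * t ^+ 2 * s ^+ 2 * (s ^+ 2 * (1 + t ^+ 2 * M)) +
   beta / 2 * (s ^+ 4 * P - Q * (s ^+ 2 * (1 + t ^+ 2 * M)) ^+ 2) by ring.
by rewrite sE; lra.
Qed.

Lemma local_min_modulus a beta z k : 0 < beta ->
    local_min_sphere (fobj a beta) z -> cinner a z = 0 -> z k != 0 ->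
  cabs2 (z k) = norm4pow4 z.
Proof.
move=> b0 zmin az0 zk0; have z1 := zmin.1.
(* Stretching coordinate [k] alone, projected onto the tangent space at [z]. The first-order
   condition becomes [|z_k|^2 (|z_k|^2 - Q) = 0]. *)
pose v l := ((l == k)%:R - cabs2 (z k))%:C * z l.
have rE l : rdot (z l) (v l) = ((l == k)%:R - cabs2 (z k)) * cabs2 (z l).
  by rewrite rdot_realr rdotcc.
have vz : \sum_(l < n) rdot (z l) (v l) = 0.
  under eq_bigr do rewrite rE mulrBl.
  by rewrite sumrB sum_delta -mulr_sumr -/(norm2sq z) z1 mulr1 subrr.
have [h _] := local_min_variation b0 zmin az0 vz.
have {}h : cabs2 (z k) ^+ 2 - cabs2 (z k) * norm4pow4 z = 0.
  rewrite -h -(sum_delta k (fun l => cabs2 (z l) ^+ 2)) /norm4pow4 mulr_sumr.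
  by rewrite -sumrB; apply: eq_bigr => l _; rewrite rE; ring.
apply: (@mulfI _ (cabs2 (z k))); first by rewrite cabs2_eq0.
by apply/eqP; rewrite -expr2 -subr_eq0 h.
Qed.

(** In the second-order sum, coordinates with [z k != 0] cancel by [local_min_modulus], and those
    with [z k = 0] contribute [- 2 * Q * cabs2 (v k) <= 0]. Only the one at [j] is kept. *)
Lemma local_min_second_order a beta z v j : 0 < beta ->
    local_min_sphere (fobj a beta) z -> cinner a z = 0 ->
    (forall k, rdot (z k) (v k) = 0) -> z j = 0 ->
  2 * beta * norm4pow4 z * cabs2 (v j) <= cabs2 (cinner a v).
Proof.
move=> b0 zmin az0 rv zj0.
have vz : \sum_(k < n) rdot (z k) (v k) = 0 by rewrite big1.
have [_] := local_min_variation b0 zmin az0 vz.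
have Q0 := norm4pow4_gt0 zmin.1; set Q := norm4pow4 z in Q0 *.
suff : \sum_(k < n) (4 * rdot (z k) (v k) ^+ 2 + 2 * cabs2 (z k) * cabs2 (v k))
       - 2 * Q * norm2sq v <= - 2 * Q * cabs2 (v j).
  by move=> h1 h2; nra.
rewrite /norm2sq mulr_sumr -sumrB (bigD1 j) //= rv zj0 cabs20.
rewrite expr0n /= !mulr0 mul0r addr0 sub0r mulNr mulNr gerDl.
apply: sumr_le0 => k _; rewrite rv expr0n /= mulr0 add0r.
have [->|zk0] := eqVneq (z k) 0; last first.
  by rewrite (local_min_modulus b0 zmin az0 zk0) subrr.
by rewrite cabs20 mulr0 mul0r sub0r oppr_le0 !mulr_ge0 ?cabs2_ge0 // ltW.
Qed.

Lemma cinner_two_point a j l (x y : R[i]) : l != j ->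
  cinner a (fun k => if k == l then x else if k == j then y else 0) =
  (a l)^* * x + (a j)^* * y.
Proof.
rewrite eq_sym => jl; rewrite /cinner (bigD1 l) //= eqxx (bigD1 j) //=.
rewrite (negPf jl) eqxx big1 ?addr0 // => k /andP[/negPf -> /negPf ->].
by rewrite mulr0.
Qed.

Lemma cinner_single a j (x : R[i]) :
  cinner a (fun k => if k == j then x else 0) = (a j)^* * x.
Proof.
rewrite /cinner (bigD1 j) //= eqxx big1 ?addr0 // => k /negPf ->.
by rewrite mulr0.
Qed.

Lemma local_min_vanishing a beta z j : 0 < beta ->
    local_min_sphere (fobj a beta) z -> cinner a z = 0 -> z j = 0 ->
  2 * beta * norm4pow4 z <= cabs2 (a j) /\
  forall l, l != j -> z l != 0 /\ a l = 0.
Proof.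
move=> b0 zmin az0 zj0.
have Q0 := norm4pow4_gt0 zmin.1.
have C0 : 0 < 2 * beta * norm4pow4 z by rewrite !mulr_gt0.
have key := fun v k => @local_min_second_order a beta z v k b0 zmin az0.
have aj : 2 * beta * norm4pow4 z <= cabs2 (a j).
  have := key (fun k => if k == j then 1 else 0) j.
  rewrite cinner_single mulr1 eqxx cabs2_conj cabs2_real expr1n mulr1.
  apply=> // k; case: eqP => [->|_]; first by rewrite zj0 rdot0l.
  exact: rdot0r.
have aj0 : (a j)^* != 0.
  by rewrite -cabs2_eq0 cabs2_conj gt_eqF // (lt_le_trans C0).
split=> // l lj.
have zl0 : z l != 0.
  apply/eqP => zl0.
  (* If [z l] vanished too, this direction would be admissible with [a^* v = 0] but [v l != 0],
     against the bound at [l]. *)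
  pose v k := if k == l then (a j)^* else if k == j then - (a l)^* else 0.
  have := key v l; rewrite cinner_two_point // /v eqxx cabs2_conj.
  rewrite mulrN [X in X - _]mulrC subrr cabs20 leNgt mulr_gt0 ?(lt_le_trans C0) //.
  move=> H; suff : false by []; apply: H => // k.
  case: eqP => [->|_]; first by rewrite zl0 rdot0l.
  by case: eqP => [->|_]; rewrite ?zj0 ?rdot0l ?rdot0r.
split=> //; apply/eqP; rewrite -cabs2_eq0 -cabs2_conj.
(* Turn the phase of [z l] and let [y] at [j] restore [a^* v = 0]. The bound at [j] forces [y = 0],
   hence [a l = 0]. *)
pose y := - ((a l)^* * ('i * z l)) / (a j)^*.
pose v k := if k == l then 'i * z l else if k == j then y else 0.
have := key v j; rewrite cinner_two_point // /v eqxx [j == l]eq_sym (negPf lj).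
rewrite [(a j)^* * y]mulrC divfK // subrr cabs20 pmulr_rle0 // => H.
have : cabs2 y <= 0.
  apply: H => // k; case: eqP => [->|_]; first exact: rdot_mulIr.
  by case: eqP => [->|_]; rewrite ?zj0 ?rdot0l ?rdot0r.
rewrite le_eqVlt ltNge cabs2_ge0 orbF (cabs2_eq0 y) => /eqP y0.
have : (a l)^* * ('i * z l) == 0.
  by rewrite -oppr_eq0 -[X in X == _](divfK aj0) -/y y0 mul0r.
have i0 : ('i : R[i]) != 0 by rewrite eq_complex /= oner_eq0 andbF.
by rewrite !mulf_eq0 (negPf zl0) (negPf i0) !orbF cabs2_eq0.
Qed.

End SphereObjective.

(** * The two shapes of minimizers: necessity, existence and lower bounds *)

Section Minimizers.
Variables (R : realType) (n : nat).
Hypothesis n2 : (2 <= n)%N.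
Implicit Types (a z w : 'I_n -> R[i]) (beta : R) (j k l : 'I_n).

Definition flat z := forall k, cabs2 (z k) = n%:R^-1.

Definition flat_off j z :=
  z j = 0 /\ forall l, l != j -> cabs2 (z l) = (n%:R - 1)^-1.

Definition supported_at j a := a j != 0 /\ forall l, l != j -> a l = 0.

Lemma dim_gt0 : 0 < n%:R :> R.
Proof. by rewrite ltr0n (leq_trans _ n2). Qed.

Lemma dimB1_gt0 : 0 < n%:R - 1 :> R.
Proof. by rewrite subr_gt0 ltr1n. Qed.

Lemma sum_constD1 j (c : R) : \sum_(l < n | l != j) c = (n%:R - 1) * c.
Proof.
have : \sum_(l < n) c = n%:R * c by rewrite sumr_const card_ord mulr_natl.
by rewrite (bigD1 j) //= => h; rewrite mulrBl mul1r -h addrC addrK.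
Qed.

Lemma supported_atP a :
  #|[set k | a k != 0]| = 1%N <-> exists j, supported_at j a.
Proof.
split=> [/eqP/cards1P[j sj]|[j [aj al]]].
  have suppE k : (a k != 0) = (k == j) by rewrite -in_set1 -sj inE.
  exists j; split=> [|l lj]; first by rewrite suppE.
  by apply/eqP; rewrite -[_ == _]negbK suppE.
apply/eqP/cards1P; exists j; apply/setP => k; rewrite !inE.
by have [->|kj] := eqVneq k j; rewrite ?aj // al ?eqxx.
Qed.

Lemma cinner_supported j a z : supported_at j a -> cinner a z = (a j)^* * z j.
Proof.
move=> [_ al]; rewrite /cinner (bigD1 j) //= big1 ?addr0 // => l lj.
by rewrite al // rmorph0 mul0r.
Qed.

Lemma norm2sq_supported j a : supported_at j a -> norm2sq a = cabs2 (a j).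
Proof.
move=> [_ al]; rewrite /norm2sq (bigD1 j) //= big1 ?addr0 // => l lj.
by rewrite al // cabs20.
Qed.

Lemma flat_norm2sq z : flat z -> on_sphere z.
Proof.
move=> zf; rewrite /on_sphere /norm2sq (eq_bigr _ (fun k _ => zf k)).
by rewrite sumr_const card_ord -[_^-1 *+ n]mulr_natl divff // gt_eqF ?dim_gt0.
Qed.

Lemma flat_off_norm2sq j z : flat_off j z -> on_sphere z.
Proof.
move=> [zj zl]; rewrite /on_sphere /norm2sq (bigD1 j) //= zj cabs20 add0r.
by rewrite (eq_bigr _ zl) sum_constD1 divff // gt_eqF ?dimB1_gt0.
Qed.

(** All nonzero entries have squared modulus [Q], and at most one entry vanishes, so normalization
    gives [Q = 1/n] or [Q = 1/(n-1)]. In the second case [2 * beta * Q <= |a_j|^2] is the stated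
    threshold. *)
Lemma local_min_shape a beta z : 0 < beta ->
    local_min_sphere (fobj a beta) z -> cinner a z = 0 ->
  flat z \/ exists j, [/\ flat_off j z, supported_at j a &
                          2 * beta / (n%:R - 1) <= norm2sq a].
Proof.
move=> b0 zmin az0; have z1 := zmin.1; have Q0 := norm4pow4_gt0 z1.
have modz := fun k => @local_min_modulus R n a beta z k b0 zmin az0.
have [/existsP[j /eqP zj]|/existsPn znz] := boolP [exists j, z j == 0].
  right; exists j.
  have [aj zl] := local_min_vanishing b0 zmin az0 zj.
  have QE : norm4pow4 z = (n%:R - 1)^-1.
    apply: (@mulfI _ (n%:R - 1)); first by rewrite gt_eqF ?dimB1_gt0.
    rewrite divff ?gt_eqF ?dimB1_gt0 // -(sum_constD1 j) -z1 /norm2sq.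
    rewrite [RHS](bigD1 j) //= zj cabs20 add0r.
    by apply: eq_bigr => l lj; rewrite modz //; have [] := zl l lj.
  have aS : supported_at j a.
    split=> [|l lj]; last by have [] := zl l lj.
    by rewrite -cabs2_eq0 gt_eqF // (lt_le_trans _ aj) // !mulr_gt0.
  split=> //; last by rewrite (norm2sq_supported aS) -QE.
  by split=> // l lj; rewrite -QE modz //; have [] := zl l lj.
left=> k; rewrite modz //.
apply: (@mulfI _ n%:R); first by rewrite gt_eqF ?dim_gt0.
rewrite divff ?gt_eqF ?dim_gt0 // -[RHS]z1 /norm2sq.
rewrite (eq_bigr (fun=> norm4pow4 z)) => [|l _]; last by rewrite modz.
by rewrite sumr_const card_ord mulr_natl.
Qed.

(** The numbers [(a k)^* * z k] sum to zero and have moduli proportional to [cabs (a k)], so no side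
    exceeds the sum of the others. *)
Lemma flat_polygon a z : flat z -> cinner a z = 0 -> norminf a <= 2^-1 * norm1 a.
Proof.
move=> zf az0.
have kap0 : 0 < Num.sqrt (n%:R^-1) :> R by rewrite sqrtr_gt0 invr_gt0 dim_gt0.
have cE k : cabs ((a k)^* * z k) = Num.sqrt (n%:R^-1) * cabs (a k).
  by rewrite /cabs cabs2M cabs2_conj zf mulrC sqrtrM // invr_ge0 ltW ?dim_gt0.
apply: bigmax_le => [|k _].
  by rewrite mulr_ge0 ?invr_ge0 ?sumr_ge0 // => l _; apply: cabs_ge0.
suff : cabs (a k) <= \sum_(l < n | l != k) cabs (a l).
  by move=> h; rewrite /norm1 (bigD1 k) //=; lra.
rewrite -(ler_pM2l kap0) -cE mulr_sumr.
under eq_bigr do rewrite -cE.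
apply: le_trans (cabs_sum _ _ _).
have -> : \sum_(l < n | l != k) (a l)^* * z l = - ((a k)^* * z k).
  apply/eqP; rewrite -addr_eq0 addrC; apply/eqP.
  by rewrite -[RHS]az0 /cinner [RHS](bigD1 k).
by rewrite /cabs cabs2N.
Qed.

Lemma polygon_flat a : norminf a <= 2^-1 * norm1 a ->
  exists2 z, flat z & cinner a z = 0.
Proof.
move=> ha.
have [||||u u1 uS] := @polygon_exists R 'I_n (index_enum 'I_n)
    (fun k => cabs (a k)) 0 (index_enum_uniq _).
- by move=> k; apply: cabs_ge0.
- by [].
- by apply: sumr_ge0 => k _; apply: cabs_ge0.
- move=> k _; rewrite add0r.
  have : cabs (a k) <= norminf a by exact: le_bigmax.
  by move: ha; rewrite /norm1; lra.
have /fin_all_exists2[p p1 pE] k := polar_form ((a k)^*)%R.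
pose kap : R := Num.sqrt (n%:R^-1).
(* Cancelling the phase [p k] of [(a k)^*] turns the terms of [a^* z] into the sides [cabs (a k)]
   times [u k] of the closed polygon, scaled by [kap]. *)
exists (fun k => kap%:C * ((p k)^-1 * u k)).
  move=> k; rewrite !cabs2M cabs2_real u1 mulr1.
  have pV : cabs2 (p k)^-1 = 1.
    have pk0 : p k != 0 by rewrite -cabs2_eq0 p1 oner_eq0.
    by rewrite -[LHS]mul1r -(p1 k) -cabs2M divff // cabs2_real expr1n.
  by rewrite pV mulr1 sqr_sqrtr // invr_ge0 ltW ?dim_gt0.
rewrite cinner_scale -[RHS](mulr0 kap%:C); congr (_ * _).
rewrite /cinner -[RHS]uS; apply: eq_bigr => k _.
have pk0 : p k != 0 by rewrite -cabs2_eq0 p1 oner_eq0.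
rewrite {1}(pE k) mulrA mulfK //; congr (_%:C * _).
by rewrite /cabs cabs2_conj.
Qed.

Lemma fobj_flat a beta z : flat z -> cinner a z = 0 ->
  fobj a beta z = beta / 2 * n%:R^-1.
Proof.
move=> zf az0; rewrite /fobj az0 cabs20 mulr0 add0r; congr (_ * _).
rewrite /norm4pow4 (eq_bigr (fun=> n%:R^-1 ^+ 2)) => [|k _]; last by rewrite zf.
have n0 : n%:R != 0 :> R by rewrite gt_eqF ?dim_gt0.
by rewrite sumr_const card_ord -mulr_natl; field.
Qed.

(** On the sphere, [norm4pow4 w - 1/n] is the sum of [(|w_k|^2 - 1/n)^2]. The inner product term
    stays on the left so that equality forces it to vanish. *)
Lemma fobj_ge_flat a beta w : 0 < beta -> on_sphere w ->
  2^-1 * cabs2 (cinner a w) + beta / 2 * n%:R^-1 <= fobj a beta w.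
Proof.
move=> b0 w1; rewrite lerD2l ler_pM2l ?divr_gt0 //.
have n0 : n%:R != 0 :> R by rewrite gt_eqF ?dim_gt0.
rewrite -subr_ge0.
have -> : norm4pow4 w - n%:R^-1 =
    norm4pow4 w - 2 * n%:R^-1 * norm2sq w + \sum_(k < n) n%:R^-1 ^+ 2.
  by rewrite w1 sumr_const card_ord -[n%:R^-1 ^+ 2 *+ n]mulr_natl; field.
rewrite /norm4pow4 /norm2sq mulr_sumr -sumrB -big_split /=.
apply: sumr_ge0 => k _.
have -> : forall x y : R, x ^+ 2 - 2 * y * x + y ^+ 2 = (x - y) ^+ 2.
  by move=> x y; ring.
exact: sqr_ge0.
Qed.

Lemma fobj_flat_off a beta j z : flat_off j z -> cinner a z = 0 ->
  fobj a beta z = beta / 2 * (n%:R - 1)^-1.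
Proof.
move=> [zj zl] az0; rewrite /fobj az0 cabs20 mulr0 add0r; congr (_ * _).
rewrite /norm4pow4 (bigD1 j) //= zj cabs20 expr0n add0r.
rewrite (eq_bigr (fun=> (n%:R - 1)^-1 ^+ 2)) => [|k kj]; last by rewrite zl.
have n0 : n%:R - 1 != 0 :> R by rewrite gt_eqF ?dimB1_gt0.
by rewrite sum_constD1; field.
Qed.

(** Completing squares off [j] costs [beta * s * |w_j|^2], which the threshold on [a] pays for. The
    term in [|w_j|^4] is kept because at the threshold it alone forces [w j = 0] in case of
    equality. *)
Lemma fobj_ge_supported a beta j w : 0 < beta -> on_sphere w ->
    supported_at j a -> 2 * beta / (n%:R - 1) <= norm2sq a ->
  beta / 2 * cabs2 (w j) ^+ 2 + beta / 2 * (n%:R - 1)^-1 <= fobj a beta w.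
Proof.
move=> b0 w1 aS; rewrite (norm2sq_supported aS) => ha.
rewrite /fobj (cinner_supported _ aS) cabs2M cabs2_conj.
have n0 : n%:R - 1 != 0 :> R by rewrite gt_eqF ?dimB1_gt0.
set s := (n%:R - 1)^-1 in ha *.
have wS : \sum_(l < n | l != j) cabs2 (w l) = 1 - cabs2 (w j).
  by have := w1; rewrite /on_sphere /norm2sq (bigD1 j) //=; lra.
have : 0 <= \sum_(l < n | l != j) (cabs2 (w l) - s) ^+ 2.
  by apply: sumr_ge0 => l _; apply: sqr_ge0.
have -> : \sum_(l < n | l != j) (cabs2 (w l) - s) ^+ 2 =
    \sum_(l < n | l != j) cabs2 (w l) ^+ 2
    - 2 * s * (1 - cabs2 (w j)) + s.
  have sE : s = \sum_(l < n | l != j) s ^+ 2 by rewrite sum_constD1 /s; field.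
  rewrite [X in _ + X]sE -wS mulr_sumr -sumrB -big_split /=.
  by apply: eq_bigr => l _; ring.
rewrite /norm4pow4 [in X in _ -> X](bigD1 j) //=.
have := cabs2_ge0 (w j).
set x := cabs2 (w j); set T := \sum_(l < n | l != j) _ => x0 hT.
have h1 : 2 * beta * s * x <= cabs2 (a j) * x by rewrite ler_wpM2r.
have h2 : 0 <= beta * (T - 2 * s * (1 - x) + s) by rewrite mulr_ge0 // ltW.
lra.
Qed.

Lemma flat_off_exists j : exists z, flat_off j z.
Proof.
exists (fun k => if k == j then 0 else (Num.sqrt ((n%:R - 1)^-1))%:C).
split=> [|l /negPf ->]; first by rewrite eqxx.
by rewrite cabs2_real sqr_sqrtr // invr_ge0 ltW ?dimB1_gt0.
Qed.

End Minimizers.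

(** * The equivalence, and the agreement of local and global minimizers *)

Lemma global_local_min (R : realType) (n : nat) (f : ('I_n -> R[i]) -> R) z :
  global_min_sphere f z -> local_min_sphere f z.
Proof. by move=> [z1 zmin]; split=> //; exists 1 => // w w1 _; apply: zmin. Qed.

Theorem theorem9 (R : realType) (n : nat) (a : 'I_n -> R[i]) (beta : R) :
  (2 <= n)%N -> 0 < beta ->
  let f := fobj a beta in
  let cond := norminf a <= 2^-1 * norm1 a \/
              (#|[set k | a k != 0]| = 1%N /\
               norm2sq a >= 2 * beta / (n%:R - 1)) in
  ((exists z, local_min_sphere f z /\ cinner a z = 0) <-> cond) /\
  (cond -> forall z, (local_min_sphere f z /\ cinner a z = 0) <->
                     global_min_sphere f z).
Proof.
move=> n2 b0 f cond.
have flat_global z : flat z -> cinner a z = 0 -> global_min_sphere f z.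
  move=> zf az0; split=> [|w w1]; first exact: flat_norm2sq.
  rewrite /f (fobj_flat n2 beta zf az0).
  apply: le_trans (fobj_ge_flat n2 a b0 w1).
  by rewrite lerDr mulr_ge0 ?invr_ge0 ?cabs2_ge0.
have off_global j z : flat_off j z -> supported_at j a ->
    2 * beta / (n%:R - 1) <= norm2sq a ->
    global_min_sphere f z /\ cinner a z = 0.
  move=> zf aS ha; have az0 : cinner a z = 0.
    by rewrite (cinner_supported _ aS) zf.1 mulr0.
  split=> //; split=> [|w w1]; first exact: flat_off_norm2sq zf.
  rewrite /f (fobj_flat_off n2 beta zf az0).
  apply: le_trans (fobj_ge_supported n2 b0 w1 aS ha).
  by rewrite lerDr mulr_ge0 ?sqr_ge0 // divr_ge0 // ltW.
have local_global z : local_min_sphere f z -> cinner a z = 0 ->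
    global_min_sphere f z.
  move=> zmin az0; have [zf|[j [zf aS ha]]] := local_min_shape n2 b0 zmin az0.
    exact: flat_global.
  by have [] := off_global j z zf aS ha.
split; first split.
- move=> [z [zmin az0]].
  have [zf|[j [zf aS ha]]] := local_min_shape n2 b0 zmin az0.
    by left; apply: flat_polygon zf az0.
  by right; split=> //; apply/supported_atP; exists j.
- move=> [/(polygon_flat n2)[z zf az0]|[/supported_atP[j aS] ha]].
    by exists z; split=> //; apply/global_local_min/flat_global.
  have [z zf] := flat_off_exists R n2 j; exists z.
  by have [zmin az0] := off_global j z zf aS ha; split=> //; apply: global_local_min.
move=> hc z; split=> [[]|zmin]; first exact: local_global.
split; first exact: global_local_min.
(* Comparing [z] with an explicit minimizer [y] of the matching shape makes the lower bound tight,
   so its extra nonnegative term vanishes and [a^* z = 0]. *)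
have [z1 zle] := zmin; apply/eqP; rewrite -cabs2_eq0 eq_le cabs2_ge0 andbT.
case: hc => [/(polygon_flat n2)[y yf ay0]|[/supported_atP[j aS] ha]].
  have := zle y (flat_norm2sq n2 yf); rewrite /f (fobj_flat n2 beta yf ay0).
  by have := fobj_ge_flat n2 a b0 z1; lra.
have [y yf] := flat_off_exists R n2 j.
have [_ ay0] := off_global j y yf aS ha.
have := zle y (flat_off_norm2sq n2 yf); rewrite /f (fobj_flat_off n2 beta yf ay0).
move/(le_trans (fobj_ge_supported n2 b0 z1 aS ha)).
rewrite gerDr pmulr_rle0 ?divr_gt0 // => zj2.
have zj0 : z j = 0.
  by apply/eqP; rewrite -cabs2_eq0 -sqrf_eq0 eq_le zj2 sqr_ge0.
by rewrite (cinner_supported _ aS) zj0 mulr0 cabs20.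
Qed.
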